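(* Let $G$ be a square and let $H$ be any graph. Then the tensor (direct) product $G\times H$ is a square.
   Context: $G\times H$ has vertex set $V(G)\times V(H)$, with $(g,h)$ adjacent to $(g',h')$ iff $gg'\in E(G)$ and $hh'\in E(H)$. All graphs are finite, simple, with nonempty vertex sets. A partially labeled graph is a graph $K$ together with an injective map $\theta: L\to V(K)$, $L\subseteq\mathbb{N}$, whose image $\theta(L)$ is nonempty and a proper subset of $V(K)$; vertices in $\theta(L)$ are labeled. The square $KK$ is obtained from two disjoint copies of $K$ by identifying each labeled vertex $\theta(\ell)$ of the first copy with $\theta(\ell)$ of the second copy (keeping all edges, merging double edges). A graph is a square if it is isomorphic to $KK$ for some partially labeled graph $K$. *)

(* Defs.v *)
From HB Require Import structures.
From mathcomp Require Import all_boot finmap.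
Set Implicit Arguments.
Unset Strict Implicit.
Unset Printing Implicit Defensive.

Local Open Scope quotient_scope.

Record sgraph := SGraph {
  vertex :> finType;
  edge : rel vertex;
  edge_sym : symmetric edge;
  edge_irrefl : irreflexive edge;
  vertex_nonempty : 0 < #|vertex| }.

Definition graph_iso (G H : sgraph) : Prop :=
  exists f : G -> H,
    bijective f /\ forall x y : G, edge (f x) (f y) = edge x y.

Section Tensor.
Variables G H : sgraph.

Definition tensor_edge : rel (G * H) :=
  fun p q => edge p.1 q.1 && edge p.2 q.2.

Lemma tensor_sym : symmetric tensor_edge.
Proof. by move=> p q; rewrite /tensor_edge edge_sym [edge p.2 _]edge_sym. Qed.

Lemma tensor_irrefl : irreflexive tensor_edge.
Proof. by move=> p; rewrite /tensor_edge edge_irrefl. Qed.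

Lemma tensor_nonempty : 0 < #|{: G * H}|.
Proof. by rewrite card_prod muln_gt0 !vertex_nonempty. Qed.

Definition tensor : sgraph := SGraph tensor_sym tensor_irrefl tensor_nonempty.
End Tensor.

(* A label set L \subseteq N carrying an injection into the finite vertex set
   is automatically finite, hence L : {fset nat} loses no generality. *)
Record plgraph := PLGraph {
  plbase :> sgraph;
  pllabels : {fset nat};
  pltheta : pllabels -> plbase;
  pltheta_inj : injective pltheta;
  plimage_nonempty : [set pltheta l | l : pllabels] != set0;
  plimage_proper : [set pltheta l | l : pllabels] \proper [set: plbase] }.

Section Square.
Variable K : plgraph.

Definition labeled : {set K} := [set pltheta l | l : pllabels K].

(* The disjoint union of two copies of K: (b, v) is the vertex v of copy b. *)
Definition copies : finType := (bool * K)%type.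

Definition copies_edge : rel copies :=
  fun x y => (x.1 == y.1) && edge x.2 y.2.

Definition glue : rel copies :=
  fun x y => (x.2 == y.2) && ((x.1 == y.1) || (x.2 \in labeled)).

Lemma glue_refl : reflexive glue.
Proof. by move=> x; rewrite /glue !eqxx. Qed.

Lemma glue_sym : symmetric glue.
Proof.
by move=> x y; rewrite /glue eq_sym; case: eqP => //= ->; rewrite eq_sym.
Qed.

Lemma glue_trans : transitive glue.
Proof.
move=> y x z; rewrite /glue => /andP[/eqP-> exy] /andP[/eqP<- eyz].
rewrite eqxx /=; case/orP: exy => [/eqP->//|->]; exact: orbT.
Qed.

Canonical glue_equiv := EquivRel glue glue_refl glue_sym glue_trans.

Definition square_vertex : Type := {eq_quot glue}.
HB.instance Definition _ := EqQuotient.on square_vertex.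
HB.instance Definition _ := Choice.on square_vertex.
HB.instance Definition _ : isCountable square_vertex :=
  CanIsCountable (@reprK _ {eq_quot glue}).
HB.instance Definition _ : isFinite square_vertex :=
  CanIsFinite (@reprK _ {eq_quot glue}).

Definition square_edge : rel square_vertex :=
  fun u v => [exists x : copies, exists y : copies,
    [&& \pi_square_vertex x == u, \pi_square_vertex y == v & copies_edge x y]].

Lemma square_sym : symmetric square_edge.
Proof.
have sub u v : square_edge u v -> square_edge v u.
  case/existsP=> x /existsP[y /and3P[xu yv /andP[b e]]].
  apply/existsP; exists y; apply/existsP; exists x.
  by rewrite xu yv /copies_edge eq_sym b edge_sym.
by move=> u v; apply/idP/idP; apply: sub.
Qed.

Lemma square_irrefl : irreflexive square_edge.
Proof.
move=> u; apply/negbTE/negP.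
case/existsP=> x /existsP[y /and3P[/eqP xu /eqP yu /andP[_ e]]].
have /eqmodP/andP[/eqP exy _] : x = y %[mod {eq_quot glue}].
  by rewrite [LHS]xu [RHS]yu.
by move: e; rewrite exy edge_irrefl.
Qed.

Lemma square_nonempty : 0 < #|{: square_vertex}|.
Proof.
case/card_gt0P: (vertex_nonempty K) => v _.
by apply/card_gt0P; exists (\pi_square_vertex (true, v)).
Qed.

Definition square : sgraph := SGraph square_sym square_irrefl square_nonempty.
End Square.

Definition is_square (G : sgraph) : Prop :=
  exists K : plgraph, graph_iso G (square K).

(* Main.v *)
From mathcomp Require Import all_boot finmap.
Require Import Defs.
Set Implicit Arguments.
Unset Strict Implicit.
Unset Printing Implicit Defensive.

Local Open Scope quotient_scope.

(** If [G] is the square of [K] with labeled set [S], then [G x H] is the square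
    of [K x H] with labeled set [S x V(H)]: gluing two copies along [S] commutes
    with taking the product with [H]. To avoid working with quotients, [G] being
    the square of [K] is rephrased as the existence of a surjection from the two
    disjoint copies of [K] onto [G] whose kernel is the gluing relation and for
    which the edges of [G] are the images of the edges of the copies. *)

Section LabelBy.
Variables (K : sgraph) (S : {set K}).
Hypotheses (S_neq0 : S != set0) (S_proper : S \proper [set: K]).

(** A [plgraph] needs natural-number labels, while the construction only yields a vertex set [S];
    its elements are numbered by their rank in the enumeration of [S]. *)
Definition labels_of : {fset nat} := [fset i in iota 0 #|S|]%fset.

Lemma labels_of_lt (l : labels_of) : fsval l < #|S|.
Proof. by have := fsvalP l; rewrite in_fset /= mem_iota. Qed.

Definition labeling (l : labels_of) : K := enum_val (Ordinal (labels_of_lt l)).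

Lemma labeling_inj : injective labeling.
Proof. by move=> l m /enum_val_inj/(congr1 val)/= /val_inj. Qed.

Lemma labeling_image : [set labeling l | l : labels_of] = S.
Proof.
apply/setP=> x; apply/imsetP/idP => [[l _ ->]|Sx]; first exact: enum_valP.
have li : (enum_rank_in Sx x : nat) \in labels_of by rewrite in_fset /= mem_iota /=.
exists [` li]%fset => //; rewrite -[LHS](enum_rankK_in Sx Sx) /labeling.
by congr enum_val; apply: val_inj.
Qed.

Lemma labeling_nonempty : [set labeling l | l : labels_of] != set0.
Proof. by rewrite labeling_image. Qed.

Lemma labeling_proper : [set labeling l | l : labels_of] \proper [set: K].
Proof. by rewrite labeling_image. Qed.

Definition label_by : plgraph :=
  PLGraph labeling_inj labeling_nonempty labeling_proper.

Lemma labeled_label_by : labeled label_by = S.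
Proof. exact: labeling_image. Qed.

End LabelBy.

Definition square_cover (G : sgraph) (K : plgraph) (p : copies K -> G) : Prop :=
  [/\ forall u, exists x, p x = u,
      forall x y, (p x == p y) = glue x y
    & forall u v, edge u v = [exists x, exists y,
        [&& p x == u, p y == v & copies_edge x y]]].

Lemma eq_pi_glue (K : plgraph) (x y : copies K) :
  (\pi_(square_vertex K) x == \pi_(square_vertex K) y) = glue x y.
Proof. by apply/eqP/idP => /eqmodP. Qed.

(** The cover is the quotient map followed by the inverse isomorphism. *)
Lemma graph_iso_square_cover (G : sgraph) (K : plgraph) :
  graph_iso G (square K) -> exists p : copies K -> G, square_cover p.
Proof.
case=> f [[g fK gK] fE]; exists (fun x => g (\pi_(square_vertex K) x)); split.
- by move=> u; exists (repr (f u)); rewrite reprK fK.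
- by move=> x y; rewrite (can_eq gK) eq_pi_glue.
- move=> u v; rewrite -fE /= /square_edge.
  by apply: eq_existsb => x; apply: eq_existsb => y; rewrite !(can2_eq gK fK).
Qed.

(** [p] and the quotient map are surjections from [copies K] with the same kernel, so each factors
    through the other; the factors [f] and [g] are mutually inverse. *)
Lemma square_cover_graph_iso (G : sgraph) (K : plgraph) (p : copies K -> G) :
  square_cover p -> graph_iso G (square K).
Proof.
case=> p_surj p_glue pE.
have s_ex u : exists x, p x == u by have [x <-] := p_surj u; exists x.
pose s u := xchoose (s_ex u).
have sK : cancel s p by move=> u; apply/eqP/(xchooseP (s_ex u)).
pose f u := \pi_(square_vertex K) (s u).
have f_p x : f (p x) = \pi_(square_vertex K) x.
  by apply/eqP; rewrite eq_pi_glue -p_glue sK.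
pose g (w : square K) := p (repr w).
have gK : cancel g f by move=> w; rewrite /g f_p reprK.
have fK : cancel f g.
  by move=> u; apply/eqP; rewrite /g -[eqbRHS]sK p_glue -eq_pi_glue reprK.
exists f; split=> [|u v]; first by exists g.
rewrite pE /= /square_edge.
by apply: eq_existsb => x; apply: eq_existsb => y; rewrite -!f_p !(can_eq fK).
Qed.

Theorem theorem5p5 (G H : sgraph) (hG : is_square G) : is_square (tensor G H).
Proof.
case: hG => K /graph_iso_square_cover[p [p_surj p_glue pE]].
(* Pairing with [h0] lifts a labeled and an unlabeled vertex of [K] to the product. *)
have /card_gt0P[h0 _] := vertex_nonempty H.
pose S : {set tensor K H} := setX (labeled K) [set: H].
have S_neq0 : S != set0.
  have /set0Pn[k Sk] := plimage_nonempty K.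
  by apply/set0Pn; exists (k, h0); rewrite in_setX Sk in_setT.
have S_proper : S \proper [set: tensor K H].
  have /properP[_ [k _ nSk]] := plimage_proper K.
  apply/properP; split; first exact: subsetT.
  by exists (k, h0); rewrite ?in_setT // in_setX (negPf nSk).
exists (label_by S_neq0 S_proper).
pose q (x : copies (label_by S_neq0 S_proper)) : tensor G H :=
  (p (x.1, x.2.1), x.2.2).
apply: (@square_cover_graph_iso _ _ q); split.
- by case=> u h; have [[b k] <-] := p_surj u; exists (b, (k, h)).
- move=> [b [k h]] [c [l i]].
  (* Membership in [S] depends only on the [K]-coordinate, so gluing in the product is gluing in [K]
     plus equality in [H]. *)
  rewrite /q xpair_eqE p_glue /glue labeled_label_by in_setX in_setT /=.
  by rewrite xpair_eqE andbT andbAC.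
- move=> [u h] [v i]; rewrite /= /tensor_edge /= pE.
  (* The copy index of an edge is carried by its [K]-part alone; the [H]-part is unchanged in both
     directions. *)
  apply/andP/existsP => [[/existsP[[b k] /existsP[[c l]]]]|].
  + case/and3P=> pu pv /andP[/= bc kl] hi.
    exists (b, (k, h)); apply/existsP; exists (c, (l, i)).
    rewrite /q !xpair_eqE pu pv !eqxx /copies_edge /= bc /=.
    by rewrite /tensor_edge /= kl.
  + case=> [[b [k h']] /existsP[[c [l i']]]] /and3P[].
    rewrite /q !xpair_eqE => /andP[pu /eqP <-] /andP[pv /eqP <-].
    case/andP=> /= bc /andP[/= kl hi]; split=> //.
    apply/existsP; exists (b, k); apply/existsP; exists (c, l).
    by rewrite pu pv /copies_edge bc kl.
Qed.
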